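(* Let $x$ be a positive integer. (a) If $x\equiv 1$ or $4\pmod 8$, then there are no integers $y$ and $n\ge 2$ with $T_1(x)=y^n$. (b) If $x\equiv 4$ or $5\pmod 8$, then there are no integers $k,y,n$ with $k\ge 2$ even, $n\ge 2$ and $T_k(x)=y^n$.
   Context: For positive integers $x,k$, $T_k(x)=(x+1)^k+(x+2)^k+\cdots+(2x)^k$. *)

(* Defs.v *)
From mathcomp Require Import all_boot all_order all_algebra.

Set Implicit Arguments.
Unset Strict Implicit.
Unset Printing Implicit Defensive.

Definition T (k x : nat) : nat := \sum_(x.+1 <= i < (2 * x).+1) i ^ k.

(* Main.v *)
Require Import Defs.
From mathcomp Require Import all_boot all_order all_algebra.
From mathcomp Require Import zify.

Set Implicit Arguments.
Unset Strict Implicit.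
Unset Printing Implicit Defensive.
Import Order.TTheory GRing.Theory Num.Theory.

(** In every case T_k(x) is congruent to 2 modulo 4, hence is not a perfect
    power. For k = 1 this follows from 2 T_1(x) = x(3x + 1). For k >= 2 even,
    i^k is 1 or 0 modulo 4 according to the parity of i, so T_k(x) is congruent
    to the number of odd integers in [x + 1, 2x]. *)

(** An odd base has odd powers; for an even base, 4 divides [2 ^ n], which divides [a ^ n]. *)
Lemma expn_neq2_mod4 (a n : nat) : 2 <= n -> a ^ n %% 4 != 2.
Proof.
move=> n_ge2; have [a_odd | a_even] := boolP (odd a).
  by have := oddX a n; rewrite a_odd orbT; lia.
suff: 4 %| a ^ n by lia.
by rewrite (dvdn_trans (dvdn_exp2l 2 n_ge2)) // dvdn_exp2r // dvdn2.
Qed.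

Lemma mod4_eq2_not_power (t : nat) : t %% 4 = 2 ->
  ~ (exists (y : int) (n : nat), 2 <= n /\ (t%:Z = y ^+ n)%R).
Proof.
move=> t2 [y [n [n_ge2 /(congr1 absz)]]]; rewrite abszX /= => t_pow.
by have := expn_neq2_mod4 `|y|%N n_ge2; rewrite -t_pow t2.
Qed.

Lemma double_T1 (x : nat) : (T 1 x).*2 = x * (3 * x).+1.
Proof.
(* Adding [d] on the left avoids the truncated subtraction in [d * (m.*2 + d - 1)]. *)
have sum_interval m d : (\sum_(m <= i < m + d) i).*2 + d = d * (m.*2 + d).
  elim: d => [|d IHd]; first by rewrite !addn0 big_geq.
  by rewrite !addnS big_nat_recr ?leq_addr //=; nia.
have -> : T 1 x = \sum_(x.+1 <= i < x.+1 + x) i.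
  by rewrite addSn addnn -mul2n; apply: eq_bigr => i _; rewrite expn1.
by have := sum_interval x.+1 x; nia.
Qed.

Lemma expn_even_mod4 (k i : nat) : 2 <= k -> ~~ odd k -> i ^ k = odd i %[mod 4].
Proof.
move=> k_ge2 k_even; have k2 : k = 2 * k./2 by lia.
have sq : i ^ 2 = odd i %[mod 4].
  (* Expand the square of [i = 2 * i./2 + odd i]. *)
  have -> : i ^ 2 = (i./2 ^ 2 + odd i * i./2) * 4 + odd i by nia.
  by rewrite modnMDl.
rewrite k2 expnM -modnXm sq modnXm; congr (_ %% _).
by case: (odd i); rewrite ?exp1n // exp0n //; lia.
Qed.

Lemma sum_odd (n : nat) : \sum_(0 <= i < n) odd i = n./2.
Proof.
elim: n => [|n IHn]; first by rewrite big_geq.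
by rewrite big_nat_recr //= IHn uphalf_half addnC.
Qed.

Lemma T_even_mod4 (k x : nat) : 2 <= k -> ~~ odd k -> T k x = x./2 %[mod 4].
Proof.
move=> k_ge2 k_even; rewrite /T -modn_summ.
under eq_bigr do rewrite expn_even_mod4 //.
rewrite modn_summ; congr (_ %% _).
(* There are [x] odd integers up to [2 * x] and [x.+1./2] up to [x], which leaves [x./2]. *)
have := sum_odd (2 * x).+1.
by rewrite (@big_cat_nat _ _ _ x.+1) /= ?sum_odd; lia.
Qed.

Theorem theorem2p2 (x : nat) (hx : 0 < x) :
  ((x = 1 %[mod 8] \/ x = 4 %[mod 8]) ->
     ~ (exists (y : int) (n : nat), 2 <= n /\ ((T 1%N x)%:Z = y ^+ n)%R)) /\
  ((x = 4 %[mod 8] \/ x = 5 %[mod 8]) ->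
     ~ (exists (k : nat) (y : int) (n : nat),
          [/\ 2 <= k, ~~ odd k, 2 <= n & ((T k x)%:Z = y ^+ n)%R])).
Proof.
split=> [x_mod | x_mod [k [y [n [k_ge2 k_even n_ge2 Tk_pow]]]]].
  apply: mod4_eq2_not_power; have := double_T1 x.
  (* In both cases [x * (3 * x).+1] is 4 modulo 8, so its half is 2 modulo 4. *)
  have -> : x = 8 * (x %/ 8) + x %% 8 by lia.
  by case: x_mod => ->; nia.
apply: (@mod4_eq2_not_power (T k x)); last by exists y, n.
(* Both residues of [x] modulo 8 give [x./2] equal to 2 modulo 4. *)
by rewrite T_even_mod4 //; lia.
Qed.
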